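(* Let $(\mathcal{X},\rho)$ be a Polish space (a separable complete metric space) and let $\{P_t\}_{t\in T}$ be a Markov-Feller semigroup on $\mathcal{X}$, where either $T=\mathbb{N}_+$, or $T=\mathbb{R}_+$ and $\{P_t\}_{t\in T}$ is strongly continuous on $C_b(\mathcal{X})$. Assume that $\{P_t\}_{t\in T}$ is eventually continuous (at every point of $\mathcal{X}$), and let $\mu$ be an ergodic measure for $\{P_t\}_{t\in T}$. If $\mathrm{Int}_{\mathcal{X}}(\mathrm{supp}\,\mu)\neq\emptyset$, then $\{P_t\}_{t\in T}$ satisfies the e-property at every point of $\mathrm{Int}_{\mathcal{X}}(\mathrm{supp}\,\mu)$.
   Context: Notation: $\mathbb{R}_+=[0,\infty)$, $\mathbb{N}_+=\{1,2,\dots\}$; $\mathcal{M}(\mathcal{X})$ is the family of finite Borel measures and $\mathcal{P}(\mathcal{X})$ the family of Borel probability measures on $\mathcal{X}$; $B_b(\mathcal{X})$, $C_b(\mathcal{X})$, $L_b(\mathcal{X})$ are the spaces of bounded Borel, bounded continuous, and bounded Lipschitz real-valued functions on $\mathcal{X}$, respectively; $\|f\|_\infty=\sup_{x}|f(x)|$; $\langle f,\mu\rangle=\int_{\mathcal X} f\,d\mu$; $B(x,r)=\{y:\rho(x,y)<r\}$; $\mathrm{Int}_{\mathcal{X}}(A)$ is the interior of $A$ in $\mathcal{X}$; $\mathrm{supp}\,\mu=\{x\in\mathcal{X}:\mu(B(x,\epsilon))>0\text{ for every }\epsilon>0\}$. A Markov operator is a map $P:\mathcal{M}(\mathcal{X})\to\mathcal{M}(\mathcal{X})$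 with $P(\lambda_1\mu_1+\lambda_2\mu_2)=\lambda_1P\mu_1+\lambda_2P\mu_2$ for $\lambda_1,\lambda_2\ge0$, $\mu_1,\mu_2\in\mathcal M(\mathcal X)$, and $P\mu(\mathcal{X})=\mu(\mathcal{X})$. It is regular if there is a linear operator on $B_b(\mathcal{X})$, also denoted $P$, with $\langle f,P\mu\rangle=\langle Pf,\mu\rangle$ for all $f\in B_b(\mathcal{X})$, $\mu\in\mathcal{M}(\mathcal{X})$. It is Markov-Feller if it is regular and $P(C_b(\mathcal{X}))\subset C_b(\mathcal{X})$. A Markov-Feller semigroup $\{P_t\}_{t\in T}$ is a semigroup ($P_{s+t}=P_sP_t$, and $P_0=\mathrm{Id}$ if $0\in T$) of Markov-Feller operators. A measure $\mu\in\mathcal{P}(\mathcal{X})$ is invariant if $P_t\mu=\mu$ for all $t\in T$; ergodic measure means ergodic invariant probability measure in the usual sense. Strong continuity on $C_b(\mathcal{X})$ (for $T=\mathbb{R}_+$): $\lim_{t\searrow0}\|P_tf-f\|_\infty=0$ for every $f\in C_b(\mathcal{X})$. E-property at $z$: for every $f\in L_b(\mathcal{X})$, $\limsup_{x\to z}\sup_{t\in T}|P_tf(x)-P_tf(z)|=0$. Eventual continuity at $z$: for every $f\in L_b(\mathcal{X})$, $\limsup_{x\to z}\limsup_{t\to\infty}|P_tf(x)-P_tf(z)|=0$. *)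

(* Defs.v *)
From HB Require Import structures.
From mathcomp Require Import all_boot all_order all_algebra.
From mathcomp Require Import all_classical all_reals all_analysis.

Set Implicit Arguments.
Unset Strict Implicit.
Unset Printing Implicit Defensive.

Import Order.TTheory GRing.Theory Num.Theory.
Import numFieldNormedType.Exports.

Local Open Scope classical_set_scope.
Local Open Scope ring_scope.

HB.mixin Record isSeparable T & Topological T := {
  separableP : exists D : set T, countable D /\ dense D
}.

(* Metric, complete and separable. The distinguished point is what
   g_sigma_algebraType requires; it costs nothing here, since a space carrying
   a probability measure is nonempty. *)
#[short(type="polishType")]
HB.structure Definition Polish (R : realType) :=
  { T of Metric R T & Complete T & Pointed T & isSeparable T }.

Notation borel X := (g_sigma_algebraType (@open X)).

Section markov_semigroups.
Context {R : realType} {X : polishType R}.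

Local Notation M := {finite_measure set (borel X) -> \bar R}.

(* A library measure is a function on all sets, whose values on non-measurable
   sets carry no information: equality of measures is equality on Borel sets. *)
Definition eq_measure (mu nu : M) :=
  forall A : set (borel X), measurable A -> mu A = nu A.

Definition Bb : set (X -> R) :=
  [set f | bounded_fun f /\ measurable_fun setT (f : borel X -> R)].

Definition Cb : set (X -> R) :=
  [set f | bounded_fun f /\ continuous f].

Definition Lb : set (X -> R) :=
  [set f | bounded_fun f /\
    exists k : R, forall x y, `|f x - f y| <= k * mdist x y].

Definition sup_norm (f : X -> R) : \bar R :=
  ereal_sup [set `|f x|%:E | x in setT].

Definition pairing (f : X -> R) (mu : M) : \bar R :=
  (\int[mu]_x (f x)%:E)%E.

Definition supp (mu : M) : set X :=
  [set x | forall e : R, 0 < e -> (0 < mu (ball x e))%E].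

(* The additivity clause quantifies over every nu representing
   l1 mu1 + l2 mu2 on Borel sets; with l1 = 1 and l2 = 0 it says in particular
   that P respects eq_measure. *)
Definition markov_operator (P : M -> M) :=
  (forall (l1 l2 : R) (mu1 mu2 nu : M), 0 <= l1 -> 0 <= l2 ->
     (forall A : set (borel X), measurable A ->
        nu A = (l1%:E * mu1 A + l2%:E * mu2 A)%E) ->
     forall A : set (borel X), measurable A ->
        P nu A = (l1%:E * P mu1 A + l2%:E * P mu2 A)%E) /\
  (forall mu : M, P mu setT = mu setT).

(* U is the operator on B_b associated with a regular P; its values outside
   Bb are irrelevant. *)
Definition dual_operator (P : M -> M) (U : (X -> R) -> (X -> R)) :=
  [/\ forall f, Bb f -> Bb (U f),
      forall (a b : R) f g, Bb f -> Bb g ->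
        U (fun x => a * f x + b * g x) = (fun x => a * U f x + b * U g x)
    & forall f mu, Bb f -> pairing f (P mu) = pairing (U f) mu].

Definition markov_feller (P : M -> M) (U : (X -> R) -> (X -> R)) :=
  [/\ markov_operator P, dual_operator P U & forall f, Cb f -> Cb (U f)].

(* The time set T is a subset of R, so that discrete and continuous time are
   treated together; the values of P and U at times outside T are irrelevant. *)
Definition markov_feller_semigroup (T : set R)
    (P : R -> M -> M) (U : R -> (X -> R) -> (X -> R)) :=
  [/\ forall t, T t -> markov_feller (P t) (U t),
      forall s t, T s -> T t ->
        forall mu, eq_measure (P (s + t) mu) (P s (P t mu))
    & T 0 -> forall mu, eq_measure (P 0 mu) mu].

Definition strongly_continuous (U : R -> (X -> R) -> (X -> R)) :=
  forall f, Cb f -> sup_norm (fun x => U t f x - f x) @[t --> 0^'+] --> 0%E.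

Definition invariant_measure (T : set R) (P : R -> M -> M) (mu : M) :=
  forall t, T t -> eq_measure (P t mu) mu.

Definition ergodic (T : set R) (P : R -> M -> M)
    (U : R -> (X -> R) -> (X -> R)) (mu : probability (borel X) R) :=
  invariant_measure T P mu /\
  forall A : set (borel X), measurable A ->
    (forall t, T t -> {ae mu, forall x, U t \1_A x = \1_A x}) ->
    mu A = 0%E \/ mu A = 1%E.

(* Here and below x --> z is along the full neighbourhood filter of z: the
   quantity vanishes at x = z, and isolated points cause no degeneracy. *)
Definition e_property (T : set R) (U : R -> (X -> R) -> (X -> R)) (z : X) :=
  forall f, Lb f ->
    limf_esup (fun x => ereal_sup [set `|U t f x - U t f z|%:E | t in T])
      (nbhs z) = 0%E.

Definition eventually_continuous (T : set R) (U : R -> (X -> R) -> (X -> R))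
    (z : X) :=
  forall f, Lb f ->
    limf_esup (fun x =>
      limf_esup (fun t => `|U t f x - U t f z|%:E) (within T (pinfty_nbhs R)))
      (nbhs z) = 0%E.

End markov_semigroups.

Definition pos_nat_times {R : realType} : set R :=
  [set n%:R | n in [set n : nat | (0 < n)%N]].

Definition nonneg_times {R : realType} : set R := [set t | 0 <= t].

(* Main.v *)
Require Import Defs.
From HB Require Import structures.
From mathcomp Require Import all_boot all_order all_algebra.
From mathcomp Require Import all_classical all_reals all_analysis.
From mathcomp Require Import measurable_realfun lra.

Set Implicit Arguments.
Unset Strict Implicit.
Unset Printing Implicit Defensive.

Import Order.TTheory GRing.Theory Num.Theory.
Import numFieldNormedType.Exports.

Local Open Scope classical_set_scope.
Local Open Scope ring_scope.

(** Fix a bounded Lipschitz [f] and let [h x] be the tail oscillation at [x] of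
    the orbit of [f]: the oscillation at [x] of the functions [U t f], in the
    limit of late times and small neighbourhoods. At points where [h] vanishes
    the family [U t f] is equicontinuous for late [t]; the remaining bounded
    range of times is handled by the Feller property when time is discrete and
    by strong continuity when it is real. So it must be shown that [h = 0] in
    the interior of the support of the ergodic measure.

    The function [h] is subharmonic, [h <= U s h]
    ([tail_osc_subharmonic]). The reason is that transition probabilities from
    points close to [x] integrate Lipschitz functions almost as the one from
    [x] does, uniformly over all functions with a given bound and Lipschitz
    constant ([U_equicontinuous]). A bounded subharmonic function is constant
    almost everywhere for an ergodic measure ([subharmonic_level_01]), hence
    its integral is at most its supremum over any neighbourhood of a point of
    the support ([subharmonic_mean_le]).

    Eventual continuity is then used twice. By Baire's theorem
    ([closed_cover_interior]) it yields, for each [e], a ball inside the support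
    on which [h <= e]; so the integral of [h] vanishes ([mean_tail_osc_le0]).
    And it gives [h z <= \int h] at every point [z] of the support
    ([tail_osc_le_mean]). Indeed [h] is a decreasing limit of Lipschitz
    functions [g], and [h z <= U s h z <= U s g z] for all [s]. By eventual
    continuity the lower limit of the orbit of [g] is at least [h z - e] near
    [z]; its opposite is subharmonic, so it is constant almost everywhere, and
    its integral is at most that of [g] ([mean_le_orbit]). Letting [g] decrease
    to [h] gives the claim, and [h z <= 0]. *)

(** * Bounded Borel, continuous and Lipschitz functions *)

Section bounded_functions.
Context {R : realType} {X : polishType R}.
Implicit Types (f g : X -> R) (c k : R).

Definition bounded_by c f := forall x, `|f x| <= c.

(** One-sided, so that the bound can be checked and used without absolute
    values; exchanging [x] and [y] gives the usual two-sided estimate. *)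
Definition lipschitz_by k f := forall x y, f x - f y <= k * mdist x y.

Lemma bounded_funP f : bounded_fun f <-> exists c, bounded_by c f.
Proof.
split=> [[c [_ cf]]|[c cf]].
  by exists (c + 1) => x; apply: cf => //; rewrite ltrDl.
exists c; split; first exact: num_real.
by move=> e ce x _; apply: le_trans (cf x) (ltW ce).
Qed.

Lemma BbP f : Bb f <->
  (exists c, bounded_by c f) /\ measurable_fun setT (f : borel X -> R).
Proof. by split=> -[/bounded_funP bf mf]; split. Qed.

Lemma open_gt_measurable f :
  (forall a, open [set x | a < f x]) -> measurable_fun setT (f : borel X -> R).
Proof.
move=> fo; apply: (measurability _ (RGenOInfty.measurableE R)) => _ [_ [a ->] <-].
rewrite setTI; apply: sub_sigma_algebra.
rewrite (_ : _ @^-1` _ = [set x | a < f x])//.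
by apply/seteqP; split => x /=; rewrite in_itv/= andbT.
Qed.

Lemma open_mdistP (A : set X) :
  (forall x, A x -> exists2 e, 0 < e & forall y, mdist x y < e -> A y) -> open A.
Proof.
move=> hA; rewrite openE => x /hA[e e0 xe].
by apply/metricType_numDomainType.nbhs_mdistP; exists e.
Qed.

Lemma open_mdist_lt (x : X) (e : R) : open [set y | mdist x y < e].
Proof.
apply: open_mdistP => y /= xy; exists (e - mdist x y); first by rewrite subr_gt0.
by move=> w; have := metric_triangle x y w; lra.
Qed.

Lemma nbhs_mdist_lt (z : X) (A : set X) : nbhs z A ->
  exists2 e, 0 < e & forall y, mdist z y < e -> A y.
Proof. by move=> /metricType_numDomainType.nbhs_mdistP[e /= e0 ze]; exists e. Qed.

Lemma continuous_near f x e : continuous f -> 0 < e ->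
  exists2 d, 0 < d & forall y, mdist x y < d -> `|f y - f x| < e.
Proof.
move=> cf e0; have /cvgrPdist_lt /(_ _ e0) /nbhs_mdist_lt[d d0 xd] := cf x.
by exists d => // y /xd; rewrite distrC.
Qed.

Lemma near_continuous f :
  (forall x e, 0 < e ->
    exists2 d, 0 < d & forall y, mdist x y < d -> `|f y - f x| < e) ->
  continuous f.
Proof.
move=> nf x; apply/cvgrPdist_lt => e /(nf x)[d d0 xd].
by apply/metricType_numDomainType.nbhs_mdistP; exists d => //= y /xd; rewrite distrC.
Qed.

Lemma Cb_Bb f : Cb f -> Bb f.
Proof.
move=> [bf cf]; split=> //; apply: open_gt_measurable => a.
apply: open_mdistP => x /= ax.
have [|d d0 xd] := @continuous_near f x (f x - a) cf; first by rewrite subr_gt0.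
exists d => // y /xd; rewrite ltr_norml => /andP[+ _].
by rewrite opprB ltrBrDr subrK.
Qed.

Lemma lipschitz_byN k f : lipschitz_by k f -> lipschitz_by k (fun x => - f x).
Proof. by move=> lf x y; rewrite opprK addrC metric_sym. Qed.

Lemma bounded_byN c f : bounded_by c f -> bounded_by c (fun x => - f x).
Proof. by move=> bf x; rewrite normrN. Qed.

Lemma lipschitz_norm k f : lipschitz_by k f ->
  forall x y, `|f x - f y| <= k * mdist x y.
Proof.
by move=> lf x y; rewrite ler_norml lf andbT lerNl opprB metric_sym.
Qed.

Lemma LbP f : Lb f <->
  exists c k, [/\ 0 < c, 0 < k, bounded_by c f & lipschitz_by k f].
Proof.
split=> [[/bounded_funP[c cf] [k kf]]|[c [k [c0 k0 cf kf]]]]; last first.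
  by split; [apply/bounded_funP; exists c|exists k; exact: lipschitz_norm].
exists (`|c| + 1), (`|k| + 1); split; rewrite ?ltr_wpDl//.
  by move=> x; rewrite (le_trans (cf x))// (le_trans (ler_norm c))// lerDl.
move=> x y; rewrite (le_trans (ler_norm _))// (le_trans (kf _ _))//.
rewrite ler_wpM2r ?mdist_ge0// (le_trans (ler_norm k))//.
by rewrite lerDl.
Qed.

Lemma Lb_Cb f : Lb f -> Cb f.
Proof.
move=> /[dup] -[bf _] /LbP[c [k [c0 k0 cf kf]]]; split=> //.
apply: near_continuous => x e e0; exists (e / k); first exact: divr_gt0.
move=> y; rewrite ltr_pdivlMr// => xy.
by rewrite (le_lt_trans (lipschitz_norm kf _ _))// metric_sym mulrC.
Qed.

Lemma Lb_Bb f : Lb f -> Bb f.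
Proof. by move=> /Lb_Cb/Cb_Bb. Qed.

Lemma bounded_lipschitz_Lb c k f : bounded_by c f -> lipschitz_by k f -> Lb f.
Proof.
move=> cf kf; split; first by apply/bounded_funP; exists c.
by exists k; exact: lipschitz_norm.
Qed.

Lemma finite_equicontinuous (I : finType) (g : I -> X -> R) (z : X) e :
  (forall i, continuous (g i)) -> 0 < e ->
  exists2 d, 0 < d & forall x, mdist z x < d -> forall i, `|g i x - g i z| < e.
Proof.
move=> gc e0; have /choice[D hD] i : exists d, 0 < d /\ forall x, mdist z x < d ->
    `|g i x - g i z| < e.
  by have [d d0 zd] := continuous_near z (gc i) e0; exists d.
exists (\big[Num.min/1]_i D i).
  by apply: lt_bigmin => // i _; have [] := hD i.
move=> x zx i; have [_] := hD i; apply.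
exact: lt_le_trans zx (bigmin_le _ _ _).
Qed.

Lemma Bb_cst c : Bb ((fun=> c) : X -> R).
Proof. by apply/BbP; split; [exists `|c| => x|exact: measurable_cst]. Qed.

Lemma BbD f g : Bb f -> Bb g -> Bb (fun x => f x + g x).
Proof.
move=> /BbP[[c cf] mf] /BbP[[c' cg] mg]; apply/BbP; split.
  exists (c + c') => x; exact: le_trans (ler_normD _ _) (lerD (cf x) (cg x)).
exact: measurable_funD.
Qed.

Lemma BbZ c f : Bb f -> Bb (fun x => c * f x).
Proof.
move=> /BbP[[d df] mf]; apply/BbP; split.
  by exists (`|c| * d) => x; rewrite normrM ler_wpM2l.
exact: measurable_funM.
Qed.

Lemma BbN f : Bb f -> Bb (fun x => - f x).
Proof.
by move=> /(BbZ (-1)); rewrite (_ : (fun x => _) = fun x => - f x)//;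
  apply/funext => x; rewrite mulN1r.
Qed.

Lemma BbB f g : Bb f -> Bb g -> Bb (fun x => f x - g x).
Proof. by move=> bf /BbN; exact: BbD. Qed.

Lemma Bb_max f g : Bb f -> Bb g -> Bb (fun x => Num.max (f x) (g x)).
Proof.
move=> /BbP[[c cf] mf] /BbP[[c' cg] mg]; apply/BbP; split.
  exists (Num.max c c') => x; rewrite le_max.
  by have [_|_] := leP (f x) (g x); rewrite ?cf ?cg ?orbT.
exact: measurable_maxr.
Qed.

Lemma Bb_indic (A : set X) : measurable (A : set (borel X)) -> Bb (\1_A : X -> R).
Proof.
move=> mA; apply/BbP; split; last exact: measurable_indic.
by exists 1 => x; rewrite indicE; case: (_ \in _); rewrite ?normr1 ?normr0.
Qed.

Lemma Bb_measurable_gt f a : Bb f ->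
  measurable ([set x | a < f x] : set (borel X)).
Proof.
move=> /BbP[_ mf]; rewrite (_ : [set x | _] = (f : borel X -> R) @^-1` `]a, +oo[).
  by rewrite -[X in measurable X]setTI; exact: mf.
by apply/seteqP; split => x /=; rewrite in_itv/= andbT.
Qed.

Lemma Bb_cvg (u : nat -> X -> R) f c : (forall n, Bb (u n)) ->
  (forall n, bounded_by c (u n)) -> (forall x, u ^~ x @ \oo --> f x) ->
  Bb f /\ bounded_by c f.
Proof.
move=> bu cu uf.
have cf : bounded_by c f.
  move=> x; apply: (@closed_cvg _ _ \oo _ (u ^~ x) [set r : R | `|r| <= c]) => //.
  - rewrite (_ : [set r : R | `|r| <= c] =
        (Num.norm : R -> R) @^-1` [set r : R | r <= c])//.
    apply: closed_comp; last exact: closed_le.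
    by move=> r _; exact: norm_continuous.
  - by apply: nearW => n; exact: cu.
split=> //; apply/BbP; split; first by exists c.
apply: (@measurable_fun_cvg _ _ _ _ (u : nat -> borel X -> R)) => //.
by move=> n; have /BbP[] := bu n.
Qed.

End bounded_functions.

(** * Integration of bounded functions *)

Section mean.
Context {R : realType} {X : polishType R}.
Variable nu : {finite_measure set (borel X) -> \bar R}.
Implicit Types (f g : X -> R) (c k : R).

Definition mean f : R := \int[nu]_(x in setT) (f x).

Lemma Bb_integrable f : Bb f -> nu.-integrable setT (EFin \o (f : borel X -> R)).
Proof.
move=> [bf mf]; apply: measurable_bounded_integrable => //.
by rewrite -ge0_fin_numE// fin_num_measure.
Qed.

Lemma meanE f : Bb f -> ((mean f)%:E = pairing f nu)%E.
Proof.
by move=> /Bb_integrable bf; rewrite /mean fineK//; exact: integrable_fin_num.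
Qed.

Lemma meanD f g : Bb f -> Bb g -> mean (fun x => f x + g x) = mean f + mean g.
Proof. by move=> bf bg; rewrite /mean RintegralD//; exact: Bb_integrable. Qed.

Lemma meanB f g : Bb f -> Bb g -> mean (fun x => f x - g x) = mean f - mean g.
Proof. by move=> bf bg; rewrite /mean RintegralB//; exact: Bb_integrable. Qed.

Lemma meanZ c f : Bb f -> mean (fun x => c * f x) = c * mean f.
Proof. by move=> bf; rewrite /mean RintegralZl//; exact: Bb_integrable. Qed.

Lemma meanN f : Bb f -> mean (fun x => - f x) = - mean f.
Proof.
move=> bf; rewrite -mulN1r -meanZ//; congr mean.
by apply/funext => x; rewrite mulN1r.
Qed.

Lemma le_mean f g : Bb f -> Bb g -> (forall x, f x <= g x) -> mean f <= mean g.
Proof.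
by move=> bf bg fg; apply: le_Rintegral => //; exact: Bb_integrable.
Qed.

Lemma mean_cvg (u : nat -> X -> R) f c : (forall n, Bb (u n)) ->
  (forall n, bounded_by c (u n)) -> (forall x, u ^~ x @ \oo --> f x) ->
  mean (u n) @[n --> \oo] --> mean f.
Proof.
move=> bu cu uf; have [bf cf] := Bb_cvg bu cu uf.
apply: fine_cvg; rewrite fineK; last first.
  by apply: integrable_fin_num => //; exact: Bb_integrable.
apply: (@dominated_cvg _ _ _ nu setT measurableT
  (fun n x => (u n x)%:E) _ (cst c%:E)) => //.
- by move=> n; apply/measurable_EFinP; have /BbP[] := bu n.
- by move=> x _; apply/cvg_EFin; [exact: nearW|exact: uf].
- by apply/integrableP; have /Bb_integrable/integrableP := @Bb_cst R X c.
- by move=> n x _; rewrite lee_fin cu.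
Qed.

Hypothesis nu1 : nu setT = 1%E.

Lemma mean_cst c : mean (fun=> c) = c.
Proof. by rewrite /mean Rintegral_cst//= nu1/= mulr1. Qed.

Lemma mean_bounded c f : Bb f -> bounded_by c f -> `|mean f| <= c.
Proof.
move=> bf cf; have bc d : Bb ((fun=> d) : X -> R) := Bb_cst d.
rewrite ler_norml -(mean_cst (- c)) -{2}(mean_cst c).
apply/andP; split; apply: le_mean; try exact: bc; try exact: bf; move=> x.
  exact: lerNnormlW.
exact: ler_normlW.
Qed.

Lemma mean_indic (A : set X) : measurable (A : set (borel X)) ->
  (mean (\1_A) )%:E = nu A.
Proof.
move=> mA; rewrite meanE; last exact: Bb_indic.
by rewrite /pairing integral_indic// setIT.
Qed.

End mean.

(** * Upper envelopes, separability and the Baire property *)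

Section envelope.
Context {R : realType} {X : polishType R} {I : Type}.
Variables (D : set I) (F : I -> X -> R).

Definition envelope (x : X) : R := sup [set F i x | i in D].

Lemma le_envelope c x i : (forall j, D j -> F j x <= c) -> D i ->
  F i x <= envelope x.
Proof.
move=> Fc Di; apply: ub_le_sup; last by exists i.
by exists c => _ [j Dj <-]; exact: Fc.
Qed.

Lemma envelope_le c x : D !=set0 -> (forall j, D j -> F j x <= c) ->
  envelope x <= c.
Proof.
move=> [i Di] Fc; apply: ge_sup; first by exists (F i x), i.
by move=> _ [j Dj <-]; exact: Fc.
Qed.

Lemma envelope_lipschitz c k : D !=set0 ->
  (forall x i, D i -> F i x <= c) -> (forall i, D i -> lipschitz_by k (F i)) ->
  lipschitz_by k envelope.
Proof.
move=> D0 Fc Fk x y; rewrite lerBlDr; apply: envelope_le => // i Di.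
have := le_envelope (Fc y) Di; have := Fk _ Di x y; lra.
Qed.

Lemma open_envelope_gt c a : D !=set0 -> (forall x i, D i -> F i x <= c) ->
  (forall i, D i -> continuous (F i)) -> open [set x | a < envelope x].
Proof.
move=> [i Di] Fc Fcont; apply: open_mdistP => x /= /sup_gt[|_ [j Dj <-] ajx].
  by exists (F i x), i.
have [|d d0 xd] := @continuous_near _ _ (F j) x (F j x - a) (Fcont _ Dj).
  by rewrite subr_gt0.
exists d => // y /xd; rewrite ltr_norml => /andP[+ _].
by have := le_envelope (Fc y) Dj; lra.
Qed.

End envelope.

Section separable.
Context {R : realType} {X : polishType R}.

Lemma dense_sequence : exists p : nat -> X,
  forall x (e : R), 0 < e -> exists i, mdist (p i) x < e.
Proof.
have [D [/countable_injP[g gi] dD]] := @separableP R X.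
have /choice[p hp] n : exists x, (exists2 y, D y & g y = n) -> D x /\ g x = n.
  have [[y Dy gy]|no] := pselect (exists2 y, D y & g y = n); first by exists y.
  by exists point => /no.
exists p => x e e0.
have [||y [xy Dy]] := dD [set y | mdist x y < e].
- by exists x; rewrite /= mdistxx.
- exact: open_mdist_lt.
have [|Dp gp] := hp (g y); first by exists y.
by exists (g y); rewrite (gi _ _ _ _ gp) ?inE// metric_sym.
Qed.

End separable.

Section baire.
Context {R : realType} {X : polishType R}.

(** The local form of Baire's theorem for a complete metric space: countably
    many closed sets covering a ball cannot all have empty interior inside it.
    If they did, closed balls avoiding [F 0], [F 1], ... successively could be
    nested, and their common point would lie in no [F n]. *)
Lemma closed_cover_interior (F : nat -> set X) (z : X) (r : R) : 0 < r ->
  (forall n, closed (F n)) -> (forall x, mdist z x < r -> exists n, F n x) ->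
  exists y e n, [/\ 0 < e, mdist z y < r & forall x, mdist y x < e -> F n x].
Proof.
move=> r0 Fc zF; apply: contrapT => no.
(* a pair (x, e) is good when the closed ball of radius e about x stays inside
   the initial ball *)
pose good (b : X * R) := 0 < b.2 /\ forall y, mdist b.1 y <= b.2 -> mdist z y < r.
have next (nb : nat * (X * R)) : exists b : X * R, good nb.2 ->
    [/\ good b, b.2 <= 2^-1 ^+ nb.1, forall y, mdist b.1 y <= b.2 -> ~ F nb.1 y
      & forall y, mdist b.1 y <= b.2 -> mdist nb.2.1 y <= nb.2.2].
  case: nb => n [x e] /=; have [gxe|] := pselect (good (x, e)); last first.
    by move=> ngxe; exists (x, e) => /ngxe.
  have [e0 /= xez] := gxe.
  have [y [xy nFy]] : exists y, mdist x y < e /\ ~ F n y.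
    apply: contrapT => xF; apply: no; exists x, e, n; split => //.
      by apply: xez; rewrite mdistxx ltW.
    by move=> y xy; apply: contrapT => nFy; apply: xF; exists y.
  have /nbhs_mdist_lt[d d0 yd] : nbhs y (~` F n).
    by apply: open_nbhs_nbhs; split => //; exact: closed_openC.
  pose e' := Num.min (Num.min (d / 2) ((e - mdist x y) / 2)) (2^-1 ^+ n).
  have e'd : e' < d.
    rewrite (@le_lt_trans _ _ (d / 2))//; last by lra.
    by rewrite !ge_min lexx.
  have e'e : e' <= e - mdist x y.
    rewrite (@le_trans _ _ ((e - mdist x y) / 2))//; last by move: xy => /=; lra.
    by rewrite !ge_min lexx orbT.
  have inside w : mdist y w <= e' -> mdist x w <= e.
    by move=> yw; have := metric_triangle x y w; lra.
  exists (y, e') => _; split => //=.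
  - split => /=; last by move=> w /inside; exact: xez.
    rewrite !lt_min exprn_gt0// ?invr_gt0// andbT divr_gt0//=.
    by move: xy => /=; lra.
  - by rewrite ge_min lexx orbT.
  - by move=> w yw; apply: yd; exact: le_lt_trans e'd.
(* Iterating [next] from the pair (z, r / 2) gives the nested balls; the
   centres form a Cauchy sequence since the n-th radius is at most 2^-(n-1). *)
have [g gP] := choice next.
pose fix b n := if n is m.+1 then g (m, b m) else (z, r / 2).
have gb n : good (b n).
  elim: n => [|n IHn]; last by have [] := gP (n, b n) IHn.
  by split => [|y] /=; lra.
have bS n := gP (n, b n) (gb n).
have bmono n m : (n <= m)%N -> forall y,
    mdist (b m).1 y <= (b m).2 -> mdist (b n).1 y <= (b n).2.
  elim: m => [|m IHm]; first by rewrite leqn0 => /eqP ->.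
  rewrite leq_eqVlt => /predU1P[->//|/IHm nm] y.
  by have [_ _ _ inc] := bS m; move/inc; exact: nm.
have bnm n m : (n <= m)%N -> mdist (b n).1 (b m).1 <= (b n).2.
  by move=> nm; apply: (bmono _ _ nm); rewrite mdistxx ltW//; have [] := gb m.
have : cauchy_ex ((fun n => (b n).1) @ \oo).
  move=> e e0.
  have /cvgrPdist_lt /(_ _ e0) [n _ /(_ _ (leqnn n)) /=] :
      (2^-1 : R) ^+ n @[n --> \oo] --> (0 : R).
    by apply: cvg_expr; rewrite gtr0_norm ?invr_gt0// invf_lt1// ltr1n.
  rewrite sub0r normrN ger0_norm ?exprn_ge0 ?invr_ge0// => ne.
  exists (b n.+1).1; rewrite /fmapE; exists n.+1 => // m /= nm.
  rewrite ballEmdist/=; apply: le_lt_trans (bnm _ _ nm) _.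
  by apply: le_lt_trans ne; have [] := bS n.
move=> /cauchy_exP/cauchy_cvg/cvg_ex[l bl].
have inball n : mdist (b n).1 l <= (b n).2.
  apply/ler_addgt0Pl => e e0.
  have /metricType_numDomainType.cvgrPdist_lt /(_ _ e0) [m _ me] := bl.
  have /me/= := leq_maxr n m; have := bnm _ _ (leq_maxl n m).
  have := metric_triangle (b n).1 (b (maxn n m)).1 l.
  by rewrite (metric_sym l); lra.
have [n Fnl] : exists n, F n l.
  by apply: zF; have [_] := gb 0%N; apply; exact: inball.
by have [_ _ + _] := bS n => /(_ _ (inball n.+1)).
Qed.

End baire.

(** * Upper limits in terms of balls *)

Section unfold_limsup.
Context {R : realType} {X : polishType R}.
Variables (T : set R) (U : R -> (X -> R) -> (X -> R)) (z : X).

Lemma limf_esup_lt (Y : choiceType) (I : filteredType Y) (g : I -> \bar R)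
    (F : set_system I) (e : R) :
  0 < e -> limf_esup g F = 0%E -> exists2 V, F V & forall x, V x -> (g x < e%:E)%E.
Proof.
move=> e0 g0; have : (limf_esup g F < e%:E)%E by rewrite g0 lte_fin.
rewrite limf_esupE => /ereal_inf_lt[_ [V FV <-] gV].
exists V => // x Vx; apply: le_lt_trans gV.
by apply: ereal_sup_ubound; exists x.
Qed.

Lemma eventually_continuous_close f e : eventually_continuous T U z -> Lb f -> 0 < e ->
  exists2 d, 0 < d & forall x, mdist z x < d ->
    exists n : nat, forall t, T t -> n%:R <= t -> `|U t f x - U t f z| <= e.
Proof.
move=> ec /ec ec0 e0; have [V /nbhs_mdist_lt[d d0 zd] Ve] := limf_esup_lt e0 ec0.
exists d => // x /zd/Ve; rewrite limf_esupE.
move=> /ereal_inf_lt[_ [W [a [_ aW]] <-] We].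
exists (Num.truncn a).+1 => t Tt at_; rewrite -lee_fin; apply: le_trans (ltW We).
apply: ereal_sup_ubound; exists t => //; apply: aW => //.
exact: lt_le_trans (truncnS_gt _) at_.
Qed.

Lemma e_property_intro : T !=set0 ->
  (forall f e, Lb f -> 0 < e ->
    exists2 d, 0 < d & forall x t, mdist z x < d -> T t ->
      `|U t f x - U t f z| <= e) ->
  e_property T U z.
Proof.
move=> [t0 Tt0] hz f Lf; apply/eqP; rewrite eq_le; apply/andP; split.
  apply/lee_addgt0Pr => e e0; rewrite add0e limf_esupE.
  have [d d0 zd] := hz _ _ Lf e0.
  apply: ge_ereal_inf; exists (ereal_sup ((fun x =>
      ereal_sup [set `|U t f x - U t f z|%:E | t in T]) @` [set x | mdist z x < d])).
    exists [set x | mdist z x < d] => //.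
    by apply/metricType_numDomainType.nbhs_mdistP; exists d.
  apply: ge_ereal_sup => _ [x zx <-]; apply: ge_ereal_sup => _ [t Tt <-].
  by rewrite lee_fin zd.
apply: limf_esup_ge0; first exact: filter_not_empty.
move=> x; apply: le_ereal_sup_tmp; exists (`|U t0 f x - U t0 f z|%:E) => //.
by exists t0.
Qed.

End unfold_limsup.

(** * A Markov-Feller semigroup acting on functions *)

Section semigroup.
Context {R : realType} {X : polishType R}.
Variables (T : set R).
Variables (P : R -> {finite_measure set (borel X) -> \bar R} ->
               {finite_measure set (borel X) -> \bar R}).
Variables (U : R -> (X -> R) -> (X -> R)).
Hypothesis hP : markov_feller_semigroup T P U.
Implicit Types (f g : X -> R) (t : R) (x : X).

(** The transition probabilities: the operator [U t] is integration against
    them, which gives it positivity and continuity under bounded convergence. *)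
Definition transition t x : {finite_measure set (borel X) -> \bar R} :=
  P t (@dirac _ (borel X) x R).

Lemma transition1 t x : T t -> transition t x setT = 1%E.
Proof.
move=> Tt; have [/(_ t Tt) [[_ Pt1] _ _] _ _] := hP.
by rewrite /transition Pt1; exact: diracT.
Qed.

Lemma U_Bb t f : T t -> Bb f -> Bb (U t f).
Proof. by case: hP => /(_ t) + _ _ => /[apply] -[_ [+ _ _] _]; exact. Qed.

Lemma U_Cb t f : T t -> Cb f -> Cb (U t f).
Proof. by case: hP => /(_ t) + _ _ => /[apply] -[_ _]; exact. Qed.

Lemma mean_P t f nu : T t -> Bb f -> mean (P t nu) f = mean nu (U t f).
Proof.
move=> Tt bf; apply/EFin_inj; rewrite !meanE//; last exact: U_Bb.
by case: hP => /(_ t Tt) [_ [_ _ +] _] _ _; exact.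
Qed.

Lemma U_mean t f x : T t -> Bb f -> U t f x = mean (transition t x) f.
Proof.
move=> Tt bf; rewrite mean_P//; apply/EFin_inj.
have bUf := U_Bb Tt bf; rewrite meanE// /pairing integral_dirac//.
- by rewrite [X in (X * _)%E]diracT mul1e.
- by apply/measurable_EFinP; have /BbP[] := bUf.
Qed.

(** The law [P (s + t) = P s \o P t] concerns measures equal on Borel sets;
    testing it on a Dirac mass turns it into an identity between functions. *)
Lemma U_semigroup s t f x : T s -> T t -> T (s + t) -> Bb f ->
  U (s + t) f x = U s (U t f) x.
Proof.
move=> Ts Tt Tst bf; have bUf := U_Bb Tt bf.
rewrite (U_mean _ Ts)// -mean_P// U_mean//; apply/EFin_inj; rewrite !meanE//.
case: hP => _ + _ => /(_ t s Tt Ts); rewrite addrC => Pst.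
by apply: eq_measure_integral => A mA _; exact: Pst.
Qed.

Lemma le_U t f g x : T t -> Bb f -> Bb g -> (forall y, f y <= g y) ->
  U t f x <= U t g x.
Proof. by move=> Tt bf bg fg; rewrite !U_mean//; exact: le_mean. Qed.

Lemma UD t f g x : T t -> Bb f -> Bb g ->
  U t (fun y => f y + g y) x = U t f x + U t g x.
Proof. by move=> Tt bf bg; rewrite !U_mean ?meanD//; exact: BbD. Qed.

Lemma UB t f g x : T t -> Bb f -> Bb g ->
  U t (fun y => f y - g y) x = U t f x - U t g x.
Proof. by move=> Tt bf bg; rewrite !U_mean ?meanB//; exact: BbB. Qed.

Lemma UZ t c f x : T t -> Bb f -> U t (fun y => c * f y) x = c * U t f x.
Proof. by move=> Tt bf; rewrite !U_mean ?meanZ//; exact: BbZ. Qed.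

Lemma UN t f x : T t -> Bb f -> U t (fun y => - f y) x = - U t f x.
Proof. by move=> Tt bf; rewrite !U_mean ?meanN//; exact: BbN. Qed.

Lemma U_cst t c x : T t -> U t (fun=> c) x = c.
Proof.
by move=> Tt; rewrite U_mean ?mean_cst//; [exact: transition1|exact: Bb_cst].
Qed.

Lemma U_bounded t f c : T t -> Bb f -> bounded_by c f -> bounded_by c (U t f).
Proof.
by move=> Tt bf cf x; rewrite U_mean// mean_bounded//; exact: transition1.
Qed.

Lemma U_cvg t (u : nat -> X -> R) f c x : T t -> (forall n, Bb (u n)) ->
  (forall n, bounded_by c (u n)) -> (forall y, u ^~ y @ \oo --> f y) ->
  U t (u n) x @[n --> \oo] --> U t f x.
Proof.
move=> Tt bu cu uf; have [bf _] := Bb_cvg bu cu uf.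
rewrite U_mean//; under eq_fun do rewrite U_mean//.
exact: mean_cvg cu uf.
Qed.

End semigroup.

(** * Uniform Feller property on bounded sets of Lipschitz functions *)

Section equicontinuity_on_lipschitz_balls.
Context {R : realType} {X : polishType R}.
Implicit Types (f g : X -> R) (c k : R).

(** The McShane extension of the values [a i] at the points [p i], capped at
    [c]: the largest [k]-Lipschitz function bounded by [c] and by [a i] at
    [p i]. *)
Definition mcshane (k : R) (p : nat -> X) (N : nat) (a : nat -> R) c (y : X) : R :=
  \big[Num.min/c]_(i < N) (a i + k * mdist y (p i)).

Lemma mcshane_lipschitz k p N a c : 0 <= k -> lipschitz_by k (mcshane k p N a c).
Proof.
move=> k0 x y; rewrite /mcshane.
apply: (@big_ind2 _ _ (fun u v => u - v <= k * mdist x y)).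
- by rewrite subrr mulr_ge0// mdist_ge0.
- by move=> u v u' v' uv uv'; case: (leP u u'); case: (leP v v'); lra.
- move=> i _; have := ler_wpM2l k0 (metric_triangle x y (p i)).
  by rewrite mulrDr; lra.
Qed.

Lemma mcshane_bounded k p N a c : 0 <= k -> 0 <= c ->
  (forall i, - c <= a i) -> bounded_by c (mcshane k p N a c).
Proof.
move=> k0 c0 ca x; rewrite ler_norml bigmin_le_id andbT.
apply: le_bigmin; first by lra.
by move=> i _; rewrite (le_trans (ca i))// lerDl mulr_ge0// mdist_ge0.
Qed.

Variables (T : set R).
Variables (P : R -> {finite_measure set (borel X) -> \bar R} ->
               {finite_measure set (borel X) -> \bar R}).
Variables (U : R -> (X -> R) -> (X -> R)).
Hypothesis hP : markov_feller_semigroup T P U.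

(** The Feller property makes [U t f] continuous for each [f]; here the modulus
    of continuity at [x] is the same for all [f] with a given bound and a given
    Lipschitz constant. Up to an error [eta] and away from a set of small mass
    for the transition probability from [x], such an [f] agrees with one of
    finitely many functions above it: the McShane extensions of values taken on
    a grid of mesh [eta] at finitely many points of a dense sequence. Tightness
    is needed only for the transition probability from [x], because these
    functions dominate [f] everywhere. *)
Lemma U_equicontinuous t (x : X) c k e : T t -> 0 < c -> 0 <= k -> 0 < e ->
  exists2 d, 0 < d & forall f, bounded_by c f -> lipschitz_by k f ->
    forall y, mdist x y < d -> U t f y <= U t f x + e.
Proof.
move=> Tt c0 k0 e0; have [p dp] := @dense_sequence R X.
(* The total error is 3 eta (grid and radius) + eta (mass off the balls)
   + eta (continuity of the finitely many test functions). *)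
pose eta := e / 5; have eta0 : 0 < eta by rewrite divr_gt0.
pose r := eta / (k + 1); have r0 : 0 < r by rewrite divr_gt0// ltr_wpDl.
have kr : k * r <= eta.
  by rewrite /r mulrA ler_pdivrMr ?ltr_wpDl// mulrDr mulr1 mulrC lerDl ltW.
(* the part of the space not reached by the first N balls *)
pose C N := [set y | forall i, (i < N)%N -> r <= mdist (p i) y].
have mC N : measurable (C N : set (borel X)).
  rewrite (_ : C N = ~` \bigcup_(i in `I_N) [set y | mdist (p i) y < r]); last first.
    apply/seteqP; split => y /= Cy.
      by move=> [i /= iN]; rewrite ltNge Cy.
    by move=> i iN; rewrite leNgt; apply/negP => iy; apply: Cy; exists i.
  apply: measurableC; apply: sub_sigma_algebra; apply: bigcup_open => i _.
  exact: open_mdist_lt.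
have [N NC] : exists N, U t (\1_(C N)) x <= eta / (2 * c).
  have : U t (\1_(C N)) x @[N --> \oo] --> U t (fun=> 0) x.
    apply: (@U_cvg _ _ _ _ _ hP _ _ _ 1) => //.
    - by move=> n; exact: Bb_indic.
    - by move=> n y; rewrite indicE; case: (_ \in _); rewrite ?normr1 ?normr0.
    - move=> y; have [i iy] := dp y r r0.
      apply: cvg_near_cst; exists i.+1 => // n /= ni.
      rewrite indicE memNset// => /(_ _ ni).
      by apply/negP; rewrite -ltNge.
  rewrite (U_cst hP)// => /cvgrPdist_le /(_ (eta / (2 * c))) [|N _].
    by rewrite divr_gt0// mulr_gt0.
  move=> /(_ _ (leqnn N))/=; rewrite sub0r normrN => /ler_normlW NC.
  by exists N.
(* m + 1 grid values suffice: a value of f + c lies between 0 and 2 c, and is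
   rounded up by at most one mesh. *)
pose m := (Num.truncn (2 * c / eta)).+1.
pose theta (a : {ffun 'I_N -> 'I_m.+1}) : X -> R :=
  mcshane k p N (fun i => if insub i is Some j then eta * (a j)%:R - c else 0) c.
have thetac a : bounded_by c (theta a).
  apply: mcshane_bounded => //; first exact: ltW.
  move=> i; case: insubP => [j _ _|_]; last by rewrite oppr_le0 ltW.
  by rewrite lerDr mulr_ge0// ltW.
have thetaL a : Lb (theta a).
  exact: bounded_lipschitz_Lb (thetac a) (mcshane_lipschitz _ _ _ _ k0).
have [d d0 hd] := finite_equicontinuous x
  (fun a => proj2 (U_Cb hP Tt (Lb_Cb (thetaL a)))) eta0.
exists d => // f cf kf y xy.
have fL := bounded_lipschitz_Lb cf kf.
have fp i : 0 <= (f (p i) + c) / eta.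
  by apply: divr_ge0; [have := lerNnormlW (cf (p i)); lra|exact: ltW].
pose a := [ffun i : 'I_N => inord (Num.truncn ((f (p i) + c) / eta)).+1 : 'I_m.+1].
have aE (i : 'I_N) : f (p i) <= eta * (a i)%:R - c <= f (p i) + eta.
  rewrite ffunE inordK; last first.
    rewrite ltnS /m ltnS; apply: le_truncn.
    by rewrite ler_pM2r ?invr_gt0//; have := ler_normlW (cf (p i)); lra.
  have /andP[h1 h2] := truncn_itv (fp i).
  move: h1 h2; rewrite ler_pdivlMr// ltr_pdivrMr// -natr1.
  by move=> h1 h2; apply/andP; split; lra.
have ftheta w : f w <= theta a w.
  apply: le_bigmin; first exact: ler_normlW.
  move=> i _; rewrite valK; have /andP[+ _] := aE i.
  by have := kf w (p i); lra.
have thetaf w : theta a w <= f w + (3 * eta + 2 * c * \1_(C N) w).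
  rewrite indicE; have [|] := boolP (w \in C N) => wC.
    rewrite mulr1; apply: le_trans (ler_normlW (thetac a w)) _.
    by have := lerNnormlW (cf w); lra.
  have [i iw] : exists i : 'I_N, mdist w (p i) < r.
    apply: contrapT => no; move/negP: wC; apply; rewrite inE => i iN.
    rewrite leNgt metric_sym; apply/negP => iw; apply: no.
    by exists (Ordinal iN).
  rewrite mulr0 addr0; apply: le_trans (bigmin_le _ i _) _.
  rewrite valK; have /andP[_ ai] := aE i; have := kf (p i) w.
  rewrite metric_sym; have : k * mdist w (p i) <= eta.
    by apply: le_trans kr; rewrite ler_wpM2l// ltW.
  by lra.
have bf := Lb_Bb fL; have bth := Lb_Bb (thetaL a).
have b1 := Bb_indic (mC N).
have bE : Bb (fun w => 3 * eta + 2 * c * \1_(C N) w : R).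
  by apply: BbD; [exact: Bb_cst|exact: BbZ].
apply: le_trans (le_U hP _ Tt bf bth ftheta) _.
have := hd y xy a; rewrite ltr_norml => /andP[_].
have := le_U hP x Tt bth (BbD bf bE) thetaf.
rewrite (UD hP)// (UD hP)//; [|exact: Bb_cst|exact: BbZ].
rewrite (U_cst hP)// (UZ hP)//.
move: NC; rewrite ler_pdivlMr ?mulr_gt0// /eta; lra.
Qed.

End equicontinuity_on_lipschitz_balls.

(** * Ergodicity and subharmonic functions *)

Section ergodic_subharmonic.
Context {R : realType} {X : polishType R}.
Variables (T : set R).
Variables (P : R -> {finite_measure set (borel X) -> \bar R} ->
               {finite_measure set (borel X) -> \bar R}).
Variables (U : R -> (X -> R) -> (X -> R)).
Hypothesis hP : markov_feller_semigroup T P U.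
Variable mu : probability (borel X) R.
Hypothesis hmu : ergodic T P U mu.
Implicit Types (f g v : X -> R).

(** Subharmonic functions stand in for invariant ones: the functions built
    below satisfy this inequality at every point, whereas equality holds only
    almost everywhere with respect to an invariant measure. *)
Definition subharmonic v := forall t x, T t -> v x <= U t v x.

Lemma mean_invariant t f : T t -> Bb f -> mean mu (U t f) = mean mu f.
Proof.
move=> Tt bf; rewrite -(mean_P hP)//; congr fine.
case: hmu => /(_ t Tt) Pmu _.
by apply: eq_measure_integral => A mA _; exact: Pmu.
Qed.

Lemma ae_eq_of_mean f g : Bb f -> Bb g -> (forall x, f x <= g x) ->
  mean mu f = mean mu g -> {ae mu, forall x, f x = g x}.
Proof.
move=> bf bg fg mfg; have bgf := BbB bg bf.
have mgf : mean mu (fun x => g x - f x) = 0 by rewrite meanB// mfg subrr.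
have : ae_eq mu setT (fun x => (g x - f x)%:E) (cst 0%E).
  apply/ae_eq_integral_abs => //.
    by apply/measurable_EFinP; have /BbP[] := bgf.
  under eq_integral do rewrite gee0_abs ?lee_fin ?subr_ge0//.
  by have := meanE mu bgf; rewrite mgf /pairing => <-.
by apply: filterS => x /(_ Logic.I)[] /eqP; rewrite subr_eq0 => /eqP.
Qed.

(** [U t v - v] is nonnegative with zero integral. *)
Lemma subharmonic_ae v t : subharmonic v -> Bb v -> T t ->
  {ae mu, forall x, v x = U t v x}.
Proof.
move=> sv bv Tt; apply: ae_eq_of_mean => //; first exact: (U_Bb hP).
  by move=> x; exact: sv.
by rewrite mean_invariant.
Qed.

Lemma subharmonic_truncation v b : Bb v -> subharmonic v ->
  subharmonic (fun x => Num.max (v x - b) 0).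
Proof.
move=> bv sv t x Tt; have bvb : Bb (fun x => v x - b).
  by apply: BbB => //; exact: Bb_cst.
have bm := Bb_max bvb (@Bb_cst _ X 0).
rewrite ge_max; apply/andP; split.
  apply: (@le_trans _ _ (U t (fun x => v x - b) x)); last first.
    by apply: (le_U hP) => // y; rewrite le_max lexx.
  rewrite (UB hP)//; last exact: Bb_cst.
  by rewrite (U_cst hP)// lerB// sv.
rewrite -[leLHS](U_cst hP 0 x Tt); apply: (le_U hP) => //; first exact: Bb_cst.
by move=> y; rewrite le_max lexx orbT.
Qed.

(** A bounded subharmonic function is almost everywhere constant. Each
    truncation [(v - b)^+] is again subharmonic, hence almost everywhere fixed
    by [U t]; so are the slopes [q n], and in the limit the indicator of
    [v > a], to which ergodicity applies. *)
Lemma subharmonic_level_01 v a : Bb v -> subharmonic v ->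
  mu [set x | a < v x] = 0%E \/ mu [set x | a < v x] = 1%E.
Proof.
move=> bv sv; set A := [set x | a < v x].
have mA : measurable (A : set (borel X)) by exact: Bb_measurable_gt.
case: hmu => _; apply=> // t Tt.
pose w b (x : X) := Num.max (v x - b) 0.
have bw b : Bb (w b).
  by apply: Bb_max; [apply: BbB => //|]; exact: Bb_cst.
have wae b : {ae mu, forall x, w b x = U t (w b) x}.
  by apply: subharmonic_ae => //; exact: subharmonic_truncation.
(* the slopes q n = min (1, (n + 1) (v - a)^+) increase to the indicator of A *)
pose q (n : nat) (x : X) := n.+1%:R * (w a x - w (a + n.+1%:R^-1) x).
have bq n : Bb (q n) by apply: BbZ; exact: BbB.
have q1 n : bounded_by 1 (q n).
  move=> x; rewrite /q /w.
  set s : R := n.+1%:R^-1.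
  have s0 : 0 < s by rewrite invr_gt0.
  have d0 : 0 <= Num.max (v x - a) 0 - Num.max (v x - (a + s)) 0 <= s.
    by case: (leP (v x - a) 0); case: (leP (v x - (a + s)) 0); lra.
  have /andP[d1 d2] := d0.
  rewrite ger0_norm ?mulr_ge0//.
  by rewrite -ler_pdivlMl// mulr1.
have qA x : q ^~ x @ \oo --> (\1_A x : R).
  rewrite indicE; have [|] := boolP (x \in A); rewrite (inE, notin_setE) /A /= => ax.
    have xa0 : 0 < v x - a by rewrite subr_gt0.
    have [N _ hN] : \forall n \near \oo, n.+1%:R^-1 < v x - a.
      exact: near_infty_natSinv_lt (PosNum xa0).
    apply: cvg_near_cst; exists N => // n /hN /= nv.
    rewrite /q /w; set s := _^-1 in nv *.
    have -> : Num.max (v x - a) 0 - Num.max (v x - (a + s)) 0 = s.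
      by case: (leP (v x - a) 0); case: (leP (v x - (a + s)) 0); lra.
    by rewrite /s divff.
  apply: cvg_near_cst; apply: nearW => n.
  rewrite /q /w; set s := n.+1%:R^-1.
  have s0 : 0 < s by rewrite invr_gt0.
  have -> : Num.max (v x - a) 0 - Num.max (v x - (a + s)) 0 = 0.
    by case: (leP (v x - a) 0); case: (leP (v x - (a + s)) 0); lra.
  by rewrite mulr0.
have wn : {ae mu, forall x n, w (a + n.+1%:R^-1) x = U t (w (a + n.+1%:R^-1)) x}.
  by apply: ae_foralln => n; exact: wae.
have FF : Filter (almost_everywhere mu) by exact: _.
move: wn (wae a); apply: (@filterS2 _ _ FF) => x wn wa.
have Uq n : U t (q n) x = q n x.
  rewrite /q (UZ hP)//; last exact: BbB.
  by rewrite (UB hP)// -wn -wa.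
have := @U_cvg _ _ _ _ _ hP t q _ 1 x Tt bq q1 qA.
under eq_fun do rewrite Uq.
by move=> /cvg_lim <- //; have /cvg_lim := qA x; apply.
Qed.

End ergodic_subharmonic.

(** * Consequences of ergodicity at points of the support *)

Section support_bounds.
Context {R : realType} {X : polishType R}.
Variables (T : set R).
Variables (P : R -> {finite_measure set (borel X) -> \bar R} ->
               {finite_measure set (borel X) -> \bar R}).
Variables (U : R -> (X -> R) -> (X -> R)).
Hypothesis hP : markov_feller_semigroup T P U.
Variable mu : probability (borel X) R.
Hypothesis hmu : ergodic T P U mu.
Implicit Types (f g v : X -> R) (x z : X).

Lemma mean_le_of_null v b : Bb v -> mu [set x | b < v x] = 0%E -> mean mu v <= b.
Proof.
move=> bv; set A := [set x | b < v x] => muA0.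
have mA : measurable (A : set (borel X)) by exact: Bb_measurable_gt.
have /BbP[[c cv] _] := bv.
have b1 := @Bb_indic _ X A mA; have bb := @Bb_cst _ X b.
have v1 x : v x <= b + (c - b) * \1_A x.
  rewrite indicE; have [|] := boolP (x \in A); rewrite (inE, notin_setE) /A /=.
    by have := ler_normlW (cv x); lra.
  by move/negP; rewrite -leNgt; lra.
apply: le_trans (le_mean mu bv (BbD bb (BbZ (c - b) b1)) v1) _.
rewrite (meanD _ bb (BbZ (c - b) b1)) (meanZ _ (c - b) b1).
rewrite mean_cst; last exact: probability_setT.
have -> : mean mu (\1_A : X -> R) = 0.
  by apply/EFin_inj; rewrite mean_indic.
by rewrite mulr0 addr0.
Qed.

(** A neighbourhood of a point of the support has positive mass, so the level
    set above [b] does not have full mass, and is therefore null. *)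
Lemma subharmonic_mean_le v z d b : Bb v -> subharmonic T U v -> supp mu z ->
  0 < d -> (forall x, mdist z x < d -> v x <= b) -> mean mu v <= b.
Proof.
move=> bv sv suppz d0 vb; apply: mean_le_of_null => //.
have [//|muA1] := subharmonic_level_01 hP hmu b bv sv; exfalso.
have := suppz d d0; rewrite ballEmdist.
set A := [set x | b < v x] in muA1; set B := [set y | mdist z y < d] => muB.
have mA : measurable (A : set (borel X)) by exact: Bb_measurable_gt.
have mB : measurable (B : set (borel X)).
  by apply: sub_sigma_algebra; exact: open_mdist_lt.
have : (mu (A `|` B) <= 1)%E by apply: probability_le1; exact: measurableU.
rewrite measureU//; last first.
  by apply/seteqP; split => // x [/= bvx /vb]; rewrite leNgt bvx.
by rewrite [X in (X + _)%E]muA1 -[leRHS]adde0 leeD2lE// leNgt muB.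
Qed.

End support_bounds.

Section decreasing_limit.
Context {R : realType} {X : polishType R}.
Variables (u : nat -> X -> R) (c : R).
Hypothesis u_noninc : forall x, nonincreasing_seq (u ^~ x).
Hypothesis u_bounded : forall n, bounded_by c (u n).

Definition decreasing_limit x := inf (range (u ^~ x)).

Lemma cvg_decreasing_limit x : u ^~ x @ \oo --> decreasing_limit x.
Proof.
apply: nonincreasing_cvgn => //; exists (- c) => _ [n _ <-].
exact: lerNnormlW (u_bounded n x).
Qed.

Lemma decreasing_limit_le n x : decreasing_limit x <= u n x.
Proof.
apply: ge_inf; last by exists n.
by exists (- c) => _ [m _ <-]; exact: lerNnormlW (u_bounded m x).
Qed.

End decreasing_limit.

Lemma ge_cvg_lim (R : realType) (u : nat -> R) (a l : R) :
  (forall n, a <= u n) -> u @ \oo --> l -> a <= l.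
Proof.
move=> au ul; rewrite -(cvg_lim _ ul)//; apply: limr_ge; first by apply/cvg_ex; exists l.
exact: nearW.
Qed.

(** What the two time sets have in common, so that both are treated at once. *)
Definition time_set {R : realType} (T : set R) :=
  [/\ forall t, T t -> 0 <= t,
      forall s t, T s -> T t -> T (s + t),
      forall s t, T s -> T t -> s < t -> T (t - s)
    & forall a, exists2 t, T t & a <= t].

Section orbit_limsup.
Context {R : realType} {X : polishType R}.
Variables (T : set R).
Variables (P : R -> {finite_measure set (borel X) -> \bar R} ->
               {finite_measure set (borel X) -> \bar R}).
Variables (U : R -> (X -> R) -> (X -> R)).
Hypothesis hP : markov_feller_semigroup T P U.
Hypothesis hT : time_set T.
Variables (f : X -> R) (c : R).
Hypothesis fC : Cb f.
Hypothesis fc : bounded_by c f.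

Let tail (n : nat) := [set t | T t /\ n%:R <= t].

Let tail0 n : tail n !=set0.
Proof. by case: hT => _ _ _ /(_ n%:R)[t Tt nt]; exists t. Qed.

Let fB : Bb f. Proof. exact: Cb_Bb. Qed.

Let Uc t : T t -> bounded_by c (U t f).
Proof. by move=> Tt; exact: (U_bounded hP). Qed.

Let Ule n x t : tail n t -> U t f x <= c.
Proof. by move=> [Tt _]; exact/ler_normlW/Uc. Qed.

(** The supremum over late times may be uncountable; it is Borel because a
    supremum of continuous functions is lower semicontinuous. *)
Definition orbit_sup n := envelope (tail n) (U ^~ f).

Definition orbit_limsup := decreasing_limit orbit_sup.

Lemma le_orbit_sup n x t : T t -> n%:R <= t -> U t f x <= orbit_sup n x.
Proof.
by move=> Tt nt; apply: (@le_envelope _ _ _ _ (U ^~ f) c) => // s; exact: Ule.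
Qed.

Let sup_bounded n : bounded_by c (orbit_sup n).
Proof.
move=> x; rewrite ler_norml; apply/andP; split.
  have [t [Tt nt]] := tail0 n; apply: le_trans (le_orbit_sup x Tt nt).
  exact/lerNnormlW/Uc.
by apply: envelope_le => // t; exact: Ule.
Qed.

Let sup_Bb n : Bb (orbit_sup n).
Proof.
apply/BbP; split; first by exists c.
apply: open_gt_measurable => a; apply: (@open_envelope_gt _ _ _ _ _ c) => //.
- by move=> x t; exact: Ule.
- by move=> t [Tt _]; have [] := U_Cb hP Tt fC.
Qed.

Let sup_noninc x : nonincreasing_seq (orbit_sup ^~ x).
Proof.
move=> m n mn; apply: envelope_le => // t [Tt nt].
by apply: le_orbit_sup => //; apply: le_trans nt; rewrite ler_nat.
Qed.

Let cvg_sup x : orbit_sup ^~ x @ \oo --> orbit_limsup x.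
Proof. exact: (@cvg_decreasing_limit _ _ _ c). Qed.

Lemma Bb_orbit_limsup : Bb orbit_limsup.
Proof. by have [] := Bb_cvg sup_Bb sup_bounded cvg_sup. Qed.

Lemma orbit_limsup_le n x : orbit_limsup x <= orbit_sup n x.
Proof. exact: (@decreasing_limit_le _ _ _ c). Qed.

(** [U t] moves the orbit [s |-> U s f] to its part after time [t], and the
    operator applied to a supremum dominates the supremum of the images. *)
Lemma orbit_limsup_subharmonic : subharmonic T U orbit_limsup.
Proof.
move=> t x Tt; apply: (ge_cvg_lim _ (U_cvg hP Tt sup_Bb sup_bounded cvg_sup)) => n.
have [_ _ Tsub _] := hT.
apply: le_trans (orbit_limsup_le (Num.truncn (n%:R + t)).+1 x) _.
apply: envelope_le => // s [Ts ns].
have nts : n%:R + t < s by exact: lt_le_trans (truncnS_gt _) ns.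
have ts : t < s by apply: le_lt_trans nts; rewrite lerDr.
have Tst := Tsub _ _ Tt Ts ts.
have -> : U s f x = U t (U (s - t) f) x.
  by rewrite -(U_semigroup hP)// (subrKC t s).
apply: (le_U hP) => //.
  exact: (U_Bb hP).
by move=> y; apply: le_orbit_sup => //; lra.
Qed.

(** Reverse Fatou lemma, each [U t f] having the same integral as [f]. *)
Lemma mean_orbit_limsup (mu : probability (borel X) R) :
  ergodic T P U mu -> mean mu f <= mean mu orbit_limsup.
Proof.
move=> hmu; apply: (ge_cvg_lim _ (mean_cvg sup_Bb sup_bounded cvg_sup)) => n.
have [t [Tt nt]] := tail0 n; rewrite -(mean_invariant hP hmu Tt fB).
by apply: le_mean => // [|x]; [exact: (U_Bb hP)|exact: le_orbit_sup].
Qed.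

(** This replaces an ergodic theorem at the single point [z], which may belong
    to an exceptional null set. Eventual continuity carries the bound at [z] to
    [orbit_limsup] on a neighbourhood of [z], up to [e]; that function is
    subharmonic, so its integral satisfies the same bound, and it dominates the
    integral of [f]. *)
Lemma mean_le_orbit (mu : probability (borel X) R) z a :
  ergodic T P U mu -> supp mu z -> eventually_continuous T U z -> Lb f ->
  (forall t, T t -> U t f z <= a) -> mean mu f <= a.
Proof.
move=> hmu zsupp ec fL fa; apply/ler_addgt0Pr => e e0.
apply: le_trans (mean_orbit_limsup hmu) _.
have [d d0 zd] := eventually_continuous_close ec fL e0.
apply: (subharmonic_mean_le hP hmu Bb_orbit_limsup _ zsupp d0).
  exact: orbit_limsup_subharmonic.
move=> x /zd[n ne]; apply: le_trans (orbit_limsup_le n x) _.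
apply: envelope_le => // t [Tt nt].
by have := ler_normlW (ne t Tt nt); have := fa t Tt; lra.
Qed.

End orbit_limsup.

(** * The tail oscillation of an orbit *)

Section tail_oscillation.
Context {R : realType} {X : polishType R}.
Variables (T : set R).
Variables (P : R -> {finite_measure set (borel X) -> \bar R} ->
               {finite_measure set (borel X) -> \bar R}).
Variables (U : R -> (X -> R) -> (X -> R)).
Hypothesis hP : markov_feller_semigroup T P U.
Hypothesis hT : time_set T.
Variables (f : X -> R) (c : R).
Hypothesis fL : Lb f.
Hypothesis c0 : 0 < c.
Hypothesis fc : bounded_by c f.

Let fB : Bb f. Proof. exact: Lb_Bb. Qed.

Let Uc t : T t -> bounded_by c (U t f).
Proof. by move=> Tt; exact: (U_bounded hP). Qed.

Let tail (n : nat) := [set p : R * X * X | T p.1.1 /\ n%:R <= p.1.1].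

(** The penalty [n (d(x, y) + d(x, y'))] forces [y] and [y'] close to [x] when
    [n] is large, so that [tail_osc x] is the oscillation at [x] of the
    functions [U t f] for late [t]. Compared with oscillations over shrinking
    balls, penalised ones are Lipschitz in [x]. *)
Let gap (n : nat) (p : R * X * X) (x : X) : R :=
  U p.1.1 f p.1.2 - U p.1.1 f p.2 - n%:R * (mdist x p.1.2 + mdist x p.2).

Definition tail_osc_at n := envelope (tail n) (gap n).

Definition tail_osc := decreasing_limit tail_osc_at.

Let tail0 n : tail n !=set0.
Proof.
by case: hT => _ _ _ /(_ n%:R)[t Tt nt]; exists (t, point, point).
Qed.

Let gap_le n x p : tail n p -> gap n p x <= 2 * c.
Proof.
move=> [Tp _]; rewrite /gap.
have := ler_normlW (Uc Tp p.1.2); have := lerNnormlW (Uc Tp p.2).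
have : 0 <= n%:R * (mdist x p.1.2 + mdist x p.2).
  by rewrite mulr_ge0// addr_ge0// mdist_ge0.
lra.
Qed.

Lemma le_tail_osc_at n t x y y' : T t -> n%:R <= t ->
  U t f y - U t f y' - n%:R * (mdist x y + mdist x y') <= tail_osc_at n x.
Proof.
move=> Tt nt; apply: (@le_envelope _ _ _ _ (gap n) (2 * c) x (t, y, y')) => //.
by move=> p; exact: gap_le.
Qed.

Lemma tail_osc_at_ge0 n x : 0 <= tail_osc_at n x.
Proof.
case: hT => _ _ _ /(_ n%:R)[t Tt nt].
by have := le_tail_osc_at x x x Tt nt; rewrite !mdistxx subrr addr0 mulr0 subrr.
Qed.

Let tail_osc_at_bounded n : bounded_by (2 * c) (tail_osc_at n).
Proof.
move=> x; rewrite ger0_norm ?tail_osc_at_ge0//.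
by apply: envelope_le => // p; exact: gap_le.
Qed.

Lemma tail_osc_at_lipschitz n : lipschitz_by (2 * n%:R) (tail_osc_at n).
Proof.
apply: (@envelope_lipschitz _ _ _ _ _ (2 * c)) => // [x p|p _ x w]; first exact: gap_le.
rewrite /gap.
have := ler_wpM2l (ler0n R n) (metric_triangle w x p.1.2).
have := ler_wpM2l (ler0n R n) (metric_triangle w x p.2).
rewrite !mulrDr (metric_sym w x); lra.
Qed.

Lemma tail_osc_at_Lb n : Lb (tail_osc_at n).
Proof.
exact: bounded_lipschitz_Lb (tail_osc_at_bounded n) (@tail_osc_at_lipschitz n).
Qed.

Let tail_osc_at_Bb n : Bb (tail_osc_at n).
Proof. exact/Lb_Bb/tail_osc_at_Lb. Qed.

Let tail_osc_at_noninc x : nonincreasing_seq (tail_osc_at ^~ x).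
Proof.
move=> m n mn; apply: envelope_le => // -[[t y] y'] [/= Tt nt].
have mnR : m%:R <= n%:R :> R by rewrite ler_nat.
apply: le_trans (le_tail_osc_at x y y' Tt (le_trans mnR nt)).
by rewrite /gap/= lerB// ler_wpM2r// addr_ge0// mdist_ge0.
Qed.

Let cvg_tail_osc_at x : tail_osc_at ^~ x @ \oo --> tail_osc x.
Proof. exact: (@cvg_decreasing_limit _ _ _ (2 * c)). Qed.

Lemma tail_osc_le n x : tail_osc x <= tail_osc_at n x.
Proof. exact: (@decreasing_limit_le _ _ _ (2 * c)). Qed.

Lemma Bb_tail_osc : Bb tail_osc.
Proof. by have [] := Bb_cvg tail_osc_at_Bb tail_osc_at_bounded cvg_tail_osc_at. Qed.

Lemma mean_tail_osc_at (mu : probability (borel X) R) :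
  mean mu (tail_osc_at n) @[n --> \oo] --> mean mu tail_osc.
Proof. exact: mean_cvg tail_osc_at_Bb tail_osc_at_bounded cvg_tail_osc_at. Qed.

(** The least [n]-Lipschitz function above [g]. *)
Let hull n (g : X -> R) := envelope setT (fun y x => g y - n%:R * mdist x y).

Let hull_ge n g x : bounded_by c g -> g x <= hull n g x.
Proof.
move=> gc; have /= := @le_envelope _ _ _ setT (fun y x => g y - n%:R * mdist x y) c x x.
rewrite mdistxx mulr0 subr0; apply=> // y _.
have := ler_normlW (gc y).
have : 0 <= n%:R * mdist x y by rewrite mulr_ge0// mdist_ge0.
lra.
Qed.

Let hull_bounded n g : bounded_by c g -> bounded_by c (hull n g).
Proof.
move=> gc x; rewrite ler_norml; apply/andP; split.
  by apply: le_trans (hull_ge n x gc); exact: lerNnormlW.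
apply: envelope_le; first by exists x.
move=> y _; have := ler_normlW (gc y).
have : 0 <= n%:R * mdist x y by rewrite mulr_ge0// mdist_ge0.
lra.
Qed.

Let hull_lipschitz n g : bounded_by c g -> lipschitz_by n%:R (hull n g).
Proof.
move=> gc; apply: (@envelope_lipschitz _ _ _ _ _ c); first by exists point.
- move=> x y _; have := ler_normlW (gc y).
  have : 0 <= n%:R * mdist x y by rewrite mulr_ge0// mdist_ge0.
  lra.
- move=> y _ x w; have := ler_wpM2l (ler0n R n) (metric_triangle w x y).
  rewrite !mulrDr (metric_sym w x); lra.
Qed.

Let hull_osc n t x : T t -> n%:R <= t ->
  hull n (U t f) x + hull n (fun y => - U t f y) x <= tail_osc_at n x.
Proof.
move=> Tt nt; rewrite -lerBrDr; apply: envelope_le; first by exists x.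
move=> y _; rewrite lerBrDl -lerBrDr; apply: envelope_le; first by exists x.
move=> y' _; have := le_tail_osc_at x y y' Tt nt; rewrite mulrDr; lra.
Qed.

(** Write [U t f = U s g] with [g = U (t - s) f]. At points [y], [y'] near [x],
    [g] and [- g] are dominated by their Lipschitz hulls, whose images under
    [U s] at [y], [y'] are close to those at [x], uniformly in [t], by
    [U_equicontinuous]. At [x] the two hulls add up to at most
    [tail_osc_at n]. The constant 1 in the resulting inequality is what makes
    the ergodicity argument applicable. *)
Lemma tail_osc_subharmonic : subharmonic T U tail_osc.
Proof.
move=> s x Ts.
have cvgU := U_cvg hP Ts tail_osc_at_Bb tail_osc_at_bounded cvg_tail_osc_at.
apply: (ge_cvg_lim _ (cvgU x)) => n.
apply/ler_addgt0Pr => e e0; have e20 : 0 < e / 2 by rewrite divr_gt0.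
have [d d0 xd] := U_equicontinuous hP x Ts c0 (ler0n R n) e20.
(* Times beyond m leave a remainder t - s beyond n, and the penalty with
   factor m exceeds the range 2 c of differences once y or y' is at distance d
   from x. *)
pose m := (Num.truncn (Num.max (n%:R + s) (2 * c / d))).+1.
have := truncnS_gt (Num.max (n%:R + s) (2 * c / d)).
rewrite -/m gt_max => /andP[nsm]; rewrite ltr_pdivrMr// => cm.
apply: le_trans (tail_osc_le m x) _.
apply: envelope_le => // -[[t y] y'] [/= Tt mt]; rewrite /gap /=.
have US0 : 0 <= U s (tail_osc_at n) x.
  rewrite -[leLHS](U_cst hP 0 x Ts); apply: (le_U hP) => //; first exact: Bb_cst.
  by move=> w; exact: tail_osc_at_ge0.
have [far|] := leP d (mdist x y + mdist x y').
  have := ler_normlW (Uc Tt y); have := lerNnormlW (Uc Tt y').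
  by have := ler_wpM2l (ler0n R m) far; lra.
move=> near.
have xy : mdist x y < d by apply: le_lt_trans near; rewrite lerDl mdist_ge0.
have xy' : mdist x y' < d by apply: le_lt_trans near; rewrite lerDr mdist_ge0.
have m0 : 0 <= m%:R * (mdist x y + mdist x y').
  by rewrite mulr_ge0// addr_ge0// mdist_ge0.
have [_ _ Tsub _] := hT.
have n0 : 0 <= n%:R :> R by exact: ler0n.
have st : s < t by lra.
have Tts := Tsub _ _ Ts Tt st; have nts : n%:R <= t - s by lra.
have bg := U_Bb hP Tts fB; have cg := Uc Tts.
have bhg := Lb_Bb (bounded_lipschitz_Lb (hull_bounded n cg) (hull_lipschitz n cg)).
have cNg := bounded_byN cg.
have bhNg := Lb_Bb (bounded_lipschitz_Lb (hull_bounded n cNg) (hull_lipschitz n cNg)).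
have -> : U t f y = U s (U (t - s) f) y.
  by rewrite -(U_semigroup hP)// (subrKC s t).
have -> : U t f y' = U s (U (t - s) f) y'.
  by rewrite -(U_semigroup hP)// (subrKC s t).
have := xd _ (hull_bounded n cg) (hull_lipschitz n cg) _ xy.
have := xd _ (hull_bounded n cNg) (hull_lipschitz n cNg) _ xy'.
have := le_U hP y Ts bg bhg (fun w => hull_ge n w cg).
have := le_U hP y' Ts (BbN bg) bhNg (fun w => hull_ge n w cNg).
have := le_U hP x Ts (BbD bhg bhNg) (tail_osc_at_Bb n) (fun w => hull_osc w Tts nts).
rewrite (UD hP)// (UN hP)//; lra.
Qed.

Lemma tail_osc_small n z r e x : 0 < r ->
  (forall y t, mdist z y < r -> T t -> n%:R <= t -> `|U t f y - U t f z| <= e) ->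
  mdist z x < r / 2 -> tail_osc x <= 2 * e.
Proof.
move=> r0 ze zx.
have e0 : 0 <= e.
  case: hT => _ _ _ /(_ n%:R)[t Tt nt].
  by apply: le_trans (ze z t _ Tt nt); rewrite ?mdistxx.
pose m := maxn n (Num.truncn (4 * c / r)).+1.
have nm : n%:R <= m%:R :> R by rewrite ler_nat leq_maxl.
have cm : 4 * c < m%:R * r.
  rewrite -ltr_pdivrMr//; apply: lt_le_trans (truncnS_gt _) _.
  by rewrite ler_nat leq_maxr.
apply: le_trans (tail_osc_le m x) _.
apply: envelope_le => // -[[t y] y'] [/= Tt mt]; rewrite /gap /=.
have nt := le_trans nm mt.
have m0 : 0 <= m%:R * (mdist x y + mdist x y').
  by rewrite mulr_ge0// addr_ge0// mdist_ge0.
have [far|] := leP (r / 2) (mdist x y + mdist x y').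
  have := ler_normlW (Uc Tt y); have := lerNnormlW (Uc Tt y').
  by have := ler_wpM2l (ler0n R m) far; lra.
move=> near.
have zy : mdist z y < r.
  by have := metric_triangle z x y; have := mdist_ge0 x y'; lra.
have zy' : mdist z y' < r.
  by have := metric_triangle z x y'; have := mdist_ge0 x y; lra.
have := ler_normlW (ze y t zy Tt nt); have := lerNnormlW (ze y' t zy' Tt nt).
lra.
Qed.

Lemma tail_osc0_equicontinuous z e : tail_osc z <= 0 -> 0 < e ->
  exists n d, 0 < d /\ forall y t, mdist z y < d -> T t -> n%:R <= t ->
    `|U t f y - U t f z| <= e.
Proof.
move=> z0 e0; have e20 : 0 < e / 2 by rewrite divr_gt0.
have [n ne] : exists n, tail_osc_at n z <= e / 2.
  have /cvgrPdist_le/(_ _ e20)[n _ /(_ _ (leqnn n))/=] := @cvg_tail_osc_at z.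
  rewrite distrC => /ler_normlW ne; exists n; lra.
exists n, (e / 2 / n.+1%:R); split; first by rewrite divr_gt0.
move=> y t; rewrite ltr_pdivlMr// -natr1 => zy Tt nt.
have := le_tail_osc_at z y z Tt nt; have := le_tail_osc_at z z y Tt nt.
rewrite mdistxx; have := mdist_ge0 z y; rewrite ler_norml => ? ? ?.
by apply/andP; split; lra.
Qed.

End tail_oscillation.

(** * Equicontinuity at late times in the interior of the support *)

Section equicontinuity_on_support.
Context {R : realType} {X : polishType R}.
Variables (T : set R).
Variables (P : R -> {finite_measure set (borel X) -> \bar R} ->
               {finite_measure set (borel X) -> \bar R}).
Variables (U : R -> (X -> R) -> (X -> R)).
Hypothesis hP : markov_feller_semigroup T P U.
Hypothesis hT : time_set T.
Hypothesis hec : forall z : X, eventually_continuous T U z.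
Variable mu : probability (borel X) R.
Hypothesis hmu : ergodic T P U mu.
Variables (f : X -> R) (c : R).
Hypothesis fL : Lb f.
Hypothesis c0 : 0 < c.
Hypothesis fc : bounded_by c f.

Lemma closed_tail_close z n e :
  closed [set x | forall t, T t -> n%:R <= t -> `|U t f x - U t f z| <= e].
Proof.
rewrite -[X in closed X]setCK; apply: open_closedC; apply: open_mdistP => x /= nx.
have [t [Tt nt xe]] : exists t, [/\ T t, n%:R <= t & e < `|U t f x - U t f z|].
  apply: contrapT => no; apply: nx => t Tt nt; rewrite leNgt; apply/negP => et.
  by apply: no; exists t.
have xe0 : 0 < `|U t f x - U t f z| - e by rewrite subr_gt0.
have [_ cUf] := U_Cb hP Tt (Lb_Cb fL).
have [d d0 xd] := continuous_near x cUf xe0; exists d => // y /xd yx ye.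
have := ye t Tt nt; have := ler_distD (U t f y) (U t f x) (U t f z).
rewrite (distrC (U t f x) (U t f y)); lra.
Qed.

(** Near [z] eventual continuity makes [U t f x] close to [U t f z] after a time
    depending on [x]. By Baire's theorem this time is constant on some ball
    inside the support, where the tail oscillation is therefore small; being
    subharmonic, it then has a small integral. *)
Lemma mean_tail_osc_le0 z : (supp mu)^° z -> mean mu (tail_osc T U f) <= 0.
Proof.
move=> /nbhs_mdist_lt[r r0 zr]; apply/ler_addgt0Pr => e e0; rewrite add0r.
have e40 : 0 < e / 4 by rewrite divr_gt0.
have [d d0 zd] := eventually_continuous_close (hec z) fL e40.
pose s := Num.min r d; have s0 : 0 < s by rewrite lt_min r0.
pose F n := [set x | forall t, T t -> n%:R <= t -> `|U t f x - U t f z| <= e / 4].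
have zF x : mdist z x < s -> exists n, F n x.
  by rewrite lt_min => /andP[_ /zd].
have [y [rho [n [rho0 zy yF]]]] :=
  closed_cover_interior s0 (fun n => @closed_tail_close z n (e / 4)) zF.
have suppy : supp mu y by apply: zr; move: zy; rewrite lt_min => /andP[].
have rho20 : 0 < rho / 2 by rewrite divr_gt0.
apply: (subharmonic_mean_le hP hmu (Bb_tail_osc hP hT fL fc)
  (tail_osc_subharmonic hP hT fL c0 fc) suppy rho20).
move=> x yx; rewrite (_ : e = 2 * (e / 2)); last by lra.
apply: (tail_osc_small hP hT fL fc rho0) yx => w t yw Tt nt.
have := yF w yw t Tt nt; have := yF y _ t Tt nt; rewrite mdistxx => /(_ rho0).
have := ler_distD (U t f z) (U t f w) (U t f y).
rewrite (distrC (U t f z) (U t f y)); lra.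
Qed.

(** The tail oscillation at [z] bounds from below all [U t (tail_osc_at n) z],
    hence the integral of [tail_osc_at n] by [mean_le_orbit]. *)
Lemma tail_osc_le_mean z : supp mu z -> tail_osc T U f z <= mean mu (tail_osc T U f).
Proof.
move=> suppz; apply: (ge_cvg_lim _ (mean_tail_osc_at hP hT fL fc (mu := mu))) => n.
have hL := tail_osc_at_Lb hP hT fL fc n; have hB := Lb_Bb hL.
have /LbP[b [k [_ _ hb hk]]] := hL.
rewrite -lerN2 -meanN//.
have NL := bounded_lipschitz_Lb (bounded_byN hb) (lipschitz_byN hk).
apply: (mean_le_orbit hP hT (Lb_Cb NL) (bounded_byN hb) hmu suppz (hec z) NL).
move=> t Tt; rewrite (UN hP)// lerN2.
apply: le_trans (tail_osc_subharmonic hP hT fL c0 fc z Tt) _.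
apply: (le_U hP) => //; first exact: (Bb_tail_osc hP hT fL fc).
by move=> x; exact: (tail_osc_le hP hT fL fc).
Qed.

Lemma tail_equicontinuous z e : (supp mu)^° z -> 0 < e ->
  exists n d, 0 < d /\ forall y t, mdist z y < d -> T t -> n%:R <= t ->
    `|U t f y - U t f z| <= e.
Proof.
move=> zsupp; apply: (tail_osc0_equicontinuous hP hT fL fc).
exact: le_trans (tail_osc_le_mean (interior_subset zsupp)) (mean_tail_osc_le0 zsupp).
Qed.

End equicontinuity_on_support.

(** * Equicontinuity at bounded times *)

Section bounded_times.
Context {R : realType} {X : polishType R}.
Variables (T : set R).
Variables (P : R -> {finite_measure set (borel X) -> \bar R} ->
               {finite_measure set (borel X) -> \bar R}).
Variables (U : R -> (X -> R) -> (X -> R)).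
Hypothesis hP : markov_feller_semigroup T P U.

Definition equicontinuous_before f (z : X) (n : nat) := forall e, 0 < e ->
  exists2 d, 0 < d & forall x t, mdist z x < d -> T t -> t < n%:R ->
    `|U t f x - U t f z| <= e.

Lemma time_set_pos_nat : time_set (pos_nat_times : set R).
Proof.
split=> [_ [n _ <-]//|_ _ [m m0 <-] [n n0 <-]|_ _ [m m0 <-] [n n0 <-]|a].
- by exists (m + n)%N; [rewrite /= addn_gt0 m0|rewrite natrD].
- rewrite ltr_nat => mn; exists (n - m)%N; first by rewrite /= subn_gt0.
  by rewrite natrB// ltnW.
- exists (Num.truncn a).+1%:R; last exact/ltW/truncnS_gt.
  by exists (Num.truncn a).+1.
Qed.

Lemma time_set_nonneg : time_set (nonneg_times : set R).
Proof.
rewrite /nonneg_times; split=> [//|s t /= s0 t0|s t /= _ _ /ltW|a].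
- exact: addr_ge0.
- by rewrite subr_ge0.
- by exists (Num.max a 0); rewrite /= le_max lexx ?orbT.
Qed.

Lemma equicontinuous_before_nat f z n : T = pos_nat_times -> Cb f ->
  equicontinuous_before f z n.
Proof.
move=> TE fC e e0.
have Tn (i : 'I_n) : T i.+1%:R by rewrite TE; exists i.+1.
have [d d0 zd] := finite_equicontinuous (g := fun i : 'I_n => U i.+1%:R f) z
  (fun i => proj2 (U_Cb hP (Tn i) fC)) e0.
exists d => // x t zx; rewrite {1}TE => -[[|m]// _ <-]; rewrite ltr_nat => mn.
exact/ltW/(zd x zx (Ordinal (ltnW mn))).
Qed.

(** Strong continuity makes [U t f] uniformly close to [U (j s) f], where [j s]
    is the last multiple of a small step [s] before [t]; below time [n] there
    are finitely many such multiples. *)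
Lemma equicontinuous_before_real f z n : T = nonneg_times ->
  strongly_continuous U -> Cb f -> equicontinuous_before f z n.
Proof.
move=> TE sc fC e e0; have e30 : 0 < e / 3 by rewrite divr_gt0.
have fB := Cb_Bb fC.
have Tge0 t : 0 <= t -> T t by rewrite TE.
have [s s0 hs] : exists2 s, 0 < s &
    forall t x, 0 < t -> t < s -> `|U t f x - f x| <= e / 3.
  have : \forall t \near 0^'+,
      (sup_norm (fun x => (U t f x - f x)%R) < (e / 3)%:E)%E.
    have nV : nbhs 0%E [set y : \bar R | (y < (e / 3)%:E)%E].
      apply: open_nbhs_nbhs; split; first exact: open_ereal_lt_ereal.
      by rewrite /= lte_fin.
    exact: (sc f fC _ nV).
  move=> [s /= s0 hs]; exists s => // t x t0 ts; rewrite -lee_fin.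
  apply: le_trans (ltW (hs t _ t0)); last by rewrite /= sub0r normrN gtr0_norm.
  by apply: ereal_sup_ubound; exists x.
pose N := (Num.truncn (n%:R / s)).+1.
have Tj (j : 'I_N) : T (j%:R * s) by apply: Tge0; rewrite mulr_ge0// ltW.
have [d d0 zd] := finite_equicontinuous (g := fun j : 'I_N => U (j%:R * s) f) z
  (fun j => proj2 (U_Cb hP (Tj j) fC)) e30.
exists d => // x t zx; rewrite {1}TE /nonneg_times /= => t0 tn.
have ts0 : 0 <= t / s by rewrite divr_ge0// ltW.
have jN : (Num.truncn (t / s) < N)%N.
  by rewrite ltnS; apply: le_truncn; rewrite ler_pM2r ?invr_gt0// ltW.
pose j := Ordinal jN.
have /andP[jt tj] := truncn_itv ts0.
move: jt tj; rewrite ler_pdivlMr// ltr_pdivrMr// -natr1 mulrDl mul1r => jt tj.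
have close w : `|U t f w - U (j%:R * s) f w| <= e / 3.
  have [<-|tne] := eqVneq (j%:R * s) t; first by rewrite subrr normr0 ltW.
  have r0 : 0 < t - j%:R * s by rewrite subr_gt0 lt_neqAle tne.
  have rs : t - j%:R * s < s by rewrite ltrBlDl.
  have Tr := Tge0 _ (ltW r0); have bUf := U_Bb hP Tr fB.
  have -> : U t f w = U (j%:R * s) (U (t - j%:R * s) f) w.
    rewrite -(U_semigroup hP _ (Tj j) Tr)//; first by rewrite (subrKC (j%:R * s) t).
    by rewrite subrKC; exact: Tge0.
  rewrite -(UB hP)//.
  by apply: (U_bounded hP (Tj j)) => [|y]; [exact: BbB|exact: hs].
have := zd x zx j; have := close x; have := close z => /=.
rewrite !ler_norml ltr_norml => /andP[? ?] /andP[? ?] /andP[? ?].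
by apply/andP; split; lra.
Qed.

End bounded_times.

(** * The e-property in the interior of the support *)

Theorem theorem3p4 (R : realType) (X : polishType R) (T : set R)
  (P : R -> {finite_measure set (borel X) -> \bar R} ->
            {finite_measure set (borel X) -> \bar R})
  (U : R -> (X -> R) -> (X -> R))
  (hP : markov_feller_semigroup T P U)
  (hT : T = pos_nat_times \/ (T = nonneg_times /\ strongly_continuous U))
  (hec : forall z : X, eventually_continuous T U z)
  (mu : probability (borel X) R)
  (hmu : ergodic T P U mu)
  (hint : interior (supp mu) !=set0) :
  forall z : X, interior (supp mu) z -> e_property T U z.
Proof.
have timeT : time_set T.
  by case: hT => [->|[-> _]]; [exact: time_set_pos_nat|exact: time_set_nonneg].
move=> z zsupp; apply: e_property_intro.
  by case: timeT => _ _ _ /(_ 0)[t Tt _]; exists t.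
move=> f e fL e0; have /LbP[c [_ [c0 _ fc _]]] := fL.
have [n [d [d0 late]]] := tail_equicontinuous hP timeT hec hmu fL c0 fc zsupp e0.
have /(_ e e0)[d' d'0 early] : equicontinuous_before T U f z n.
  have fC := Lb_Cb fL; case: hT => [TE|[TE sc]].
    exact: (equicontinuous_before_nat hP).
  exact: (equicontinuous_before_real hP).
exists (Num.min d d'); first by rewrite lt_min d0.
move=> x t; rewrite lt_min => /andP[zx zx'] Tt.
by have [nt|tn] := leP n%:R t; [exact: late|exact: early].
Qed.
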